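(* Let $G$ be a finite group and $H \in L(G)$. Then \[ \deg_{\mathcal{B}(G)}(H)=\begin{cases} 1, & \text{if } H=\{1\},\\ 2|e(\Gamma_{\mathrm{gen}}(H))|+\phi(|H|), & \text{if } H \text{ is cyclic},\\ 2|e(\Gamma_{\mathrm{gen}}(H))|, & \text{otherwise.} \end{cases} \]
   Context: For a group $G$, let $L(G)$ be the set of all subgroups of $G$. The graph $\mathcal{B}(G)$ is the simple undirected bipartite graph with vertex set the disjoint union $V(\mathcal{B}(G)) = (G\times G) \sqcup L(G)$, in which $(a,b)\in G\times G$ and $H \in L(G)$ are adjacent if and only if $H = \langle a,b\rangle$, and there are no other edges. $\deg_{\mathcal{B}(G)}(x)$ denotes the degree of the vertex $x$. The generating graph $\Gamma_{\mathrm{gen}}(H)$ of a finite group $H$ is the simple undirected graph with vertex set $H$ in which two distinct vertices $x,y$ are adjacent if and only if $\langle x,y\rangle = H$. For a graph $\Gamma$, $e(\Gamma)$ denotes its set of edges. $\phi(|H|)$ is the number of generators of the cyclic group $\mathbb{Z}_{|H|}$ (Euler's function). *)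

(* Defs.v *)
From mathcomp Require Import all_boot.
From mathcomp Require Import all_fingroup all_solvable.

Set Implicit Arguments.
Unset Strict Implicit.
Unset Printing Implicit Defensive.

Import GroupScope.

Record sgraph := SGraph {
  vertex :> finType;
  adj : rel vertex;
  adj_sym : symmetric adj;
  adj_irrefl : irreflexive adj
}.

Arguments adj {s} x y.

Definition deg (Gamma : sgraph) (x : Gamma) : nat := #|[set y | adj x y]|.

Definition edges (Gamma : sgraph) : {set {set Gamma}} :=
  [set [set p.1; p.2] | p : Gamma * Gamma & adj p.1 p.2].

Section GroupGraphs.

Variable gT : finGroupType.

Definition subgroup_of (G : {group gT}) := {H : {group gT} | H \subset G}.

Section SubgroupGeneratingBipartite.

Variable G : {group gT}.

Definition bip_vertex : finType :=
  ((subg_of G * subg_of G) + subgroup_of G)%type.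

Definition bip_adj : rel bip_vertex := fun u v =>
  match u, v with
  | inl (a, b), inr H | inr H, inl (a, b) =>
      val H == <<[set sgval a; sgval b]>> :> {set gT}
  | _, _ => false
  end.

Lemma bip_adj_sym : symmetric bip_adj.
Proof. by move=> [[a b]|H] [[c d]|K]. Qed.

Lemma bip_adj_irrefl : irreflexive bip_adj.
Proof. by move=> [[a b]|H]. Qed.

Definition bip_graph : sgraph := SGraph bip_adj_sym bip_adj_irrefl.

End SubgroupGeneratingBipartite.

Section GeneratingGraph.

Variable H : {group gT}.

Definition gen_adj : rel (subg_of H) := fun x y =>
  (x != y) && (<<[set sgval x; sgval y]>> == H :> {set gT}).

Lemma gen_adj_sym : symmetric gen_adj.
Proof. by move=> x y; rewrite /gen_adj eq_sym setUC. Qed.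

Lemma gen_adj_irrefl : irreflexive gen_adj.
Proof. by move=> x; rewrite /gen_adj eqxx. Qed.

Definition gen_graph : sgraph := SGraph gen_adj_sym gen_adj_irrefl.

End GeneratingGraph.

End GroupGraphs.

(* Main.v *)
(* The degree of H is the number of pairs (a, b) with <a, b> = H.  The pairs with
   a != b are the ordered edges of the generating graph, two for each edge; the
   pairs with a = b correspond to the generators of H as a cyclic group. *)
Require Import Defs.
From mathcomp Require Import all_boot.
From mathcomp Require Import all_fingroup all_solvable.

Set Implicit Arguments.
Unset Strict Implicit.
Unset Printing Implicit Defensive.

Import GroupScope.

Lemma eq_set2 (T : finType) (a b c d : T) : a != b ->
  ([set c; d] == [set a; b]) = ((c, d) == (a, b)) || ((c, d) == (b, a)).
Proof.
move=> neq_ab; rewrite !xpair_eqE; apply/eqP/orP; last first.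
  by case=> /andP[/eqP-> /eqP->] //; rewrite setUC.
move=> eq_cd.
have /set2P c_ab: c \in [set a; b] by rewrite -eq_cd set21.
have /set2P d_ab: d \in [set a; b] by rewrite -eq_cd set22.
(* Comparing cardinalities gives [c != d], which excludes the two cases where [c] and [d] are the
   same element of the pair. *)
have /eqP := congr1 (fun A : {set T} => #|A|) eq_cd.
rewrite !cards2 neq_ab eqSS eqb1 => neq_cd.
case: c_ab d_ab neq_cd => -> [] ->; rewrite ?eqxx //= => _; by [left | right].
Qed.

(** Ordered adjacent pairs are fibred over the edges. By symmetry the fibre over the edge {a, b} is
    {(a, b), (b, a)}, and irreflexivity makes these two pairs distinct. *)
Lemma card_adj_pairs (Gamma : sgraph) :
  #|[set p : Gamma * Gamma | adj p.1 p.2]| = (2 * #|edges Gamma|)%N.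
Proof.
rewrite -sum1_card (partition_big_imset (fun p : Gamma * Gamma => [set p.1; p.2])).
rewrite mulnC -sum_nat_const; apply: eq_bigr => _ /imsetP[[a b] adj_ab ->] /=.
rewrite inE /= in adj_ab.
have neq_ab: a != b by apply: contraTneq adj_ab => ->; rewrite adj_irrefl.
have neq_swap: (a, b) != (b, a) by rewrite xpair_eqE negb_and neq_ab.
rewrite sum1_card; transitivity #|[set (a, b); (b, a)]|; last first.
  by rewrite cards2 neq_swap.
apply: eq_card => -[c d]; rewrite unfold_in /= !inE /= eq_set2 //.
by apply/andb_idl => /orP[] /eqP[-> ->]; rewrite // adj_sym.
Qed.

Section GeneratingPairs.

Variable gT : finGroupType.
Implicit Types G H : {group gT}.

Definition gen_pairs H : {set gT * gT} :=
  [set p | <<[set p.1; p.2]>> == H :> {set gT}].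

(** Both entries of a pair generating [H] lie in [H], hence in [G], so the count does not depend on
    the ambient group. This links the bipartite graph of [G] to the generating graph, where the
    ambient group is [H] itself. *)
Lemma card_subg_gen_pairs G H : H \subset G ->
  #|[set p : subg_of G * subg_of G |
      <<[set sgval p.1; sgval p.2]>> == H :> {set gT}]| = #|gen_pairs H|.
Proof.
move=> sHG; pose f (p : subg_of G * subg_of G) := (sgval p.1, sgval p.2).
have inj_f: injective f.
  by move=> [a b] [c d] [/subg_inj-> /subg_inj->].
rewrite -(card_imset _ inj_f); apply: eq_card => -[x y].
apply/imsetP/idP => [[p]|]; rewrite !inE; first by move=> pH ->.
move=> /= /eqP defH; have: [set x; y] \subset G.
  by rewrite (subset_trans _ sHG) // -defH subset_gen.
rewrite subUset !sub1set => /andP[xG yG].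
by exists (subg G x, subg G y); rewrite ?inE /f /= !subgK ?defH.
Qed.

Lemma deg_bip_subgroup G (H : subgroup_of G) :
  deg (inr H : bip_graph G) = #|gen_pairs (val H)|.
Proof.
rewrite -(card_subg_gen_pairs (valP H)) /deg.
have inj_inl: injective (@inl (subg_of G * subg_of G) (subgroup_of G)).
  by move=> p q [].
rewrite -(card_imset _ inj_inl); apply: eq_card => -[p|K]; rewrite !inE.
  by rewrite mem_imset // inE eq_sym; case: p.
by apply/esym/imsetP => -[].
Qed.

Lemma card_gen_pairs H :
  #|gen_pairs H| = (2 * #|edges (gen_graph H)| + #|[set x | generator H x]|)%N.
Proof.
rewrite -card_adj_pairs -(card_subg_gen_pairs (subxx H)).
(* Split along the diagonal; the off-diagonal part is exactly the adjacency of [gen_graph H]. *)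
rewrite -(cardsID [set p : subg_of H * subg_of H | p.1 == p.2]) addnC.
congr (_ + _)%N; first by apply: eq_card => p; rewrite !inE.
have gen_in x : generator H x -> x \in H by move/eqP->; apply: cycle_id.
pose diag x := (subg H x, subg H x).
(* [subg H] takes a default value outside [H], so injectivity is claimed only on generators, which
   lie in [H]. *)
have inj_diag: {in [set x | generator H x] &, injective diag}.
  move=> x y; rewrite !inE => /gen_in xH /gen_in yH [].
  by move/(congr1 sgval); rewrite !subgK.
rewrite -(card_in_imset inj_diag); apply: eq_card => -[x y].
rewrite !inE /=; apply/andP/imsetP => [[genH /eqP eq_xy]|[z]].
  exists (sgval x); last by rewrite /diag sgvalK eq_xy.
  by rewrite inE /generator eq_sym -(eqP genH) eq_xy setUid.
rewrite inE => genz [-> ->]; split=> //.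
by rewrite subgK ?gen_in // setUid eq_sym.
Qed.

Lemma card_generators H : cyclic H -> #|[set x | generator H x]| = totient #|H|.
Proof. by case/cyclicP=> x ->; rewrite -totient_gen. Qed.

Lemma card_generators_noncyclic H :
  ~~ cyclic H -> #|[set x | generator H x]| = 0%N.
Proof.
move=> ncycH; apply: eq_card0 => x; rewrite inE.
by apply: contraNF ncycH => genx; apply/cyclicP; exists x; apply/eqP.
Qed.

End GeneratingPairs.

(** The first two cases overlap at the trivial group and agree there: its generating graph has no
    edges and [totient 1] is 1. *)
Theorem theorem2p2 (gT : finGroupType) (G : {group gT}) (H : subgroup_of G) :
  [/\ val H :=: 1 -> deg (inr H : bip_graph G) = 1%N,
      cyclic (val H) ->
        deg (inr H : bip_graph G)
          = (2 * #|edges (gen_graph (val H))| + totient #|val H|)%N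
    & val H :!=: 1 -> ~~ cyclic (val H) ->
        deg (inr H : bip_graph G) = (2 * #|edges (gen_graph (val H))|)%N].
Proof.
rewrite deg_bip_subgroup; split=> [H1|cycH|_ ncycH].
(* Only the pair (1, 1) generates the trivial group. *)
- rewrite -(cards1 (1 : gT, 1 : gT)); apply: eq_card => -[x y].
  rewrite !inE xpair_eqE H1 eqEsubset gen_subG sub1G andbT.
  by rewrite subUset !sub1set !inE.
- by rewrite card_gen_pairs card_generators.
- by rewrite card_gen_pairs card_generators_noncyclic // addn0.
Qed.
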